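(* Let $c$ and $r$ be fixed integers with $r\ge1$, and let $q,Z,z$ be indeterminates. For $n\ge0$ let $$L_q(-n,c,r)(z)=\sum_{\substack{m\ge1\\ m\equiv c\ (\mathrm{mod}\ r)}}[m]_q^n\,z^m ,$$ and let $\mu_n\in\mathbb{Q}(q,Z)$ be the $n$th moment of the shifted little $q$-Jacobi polynomials $p_n\big(q^{-c}(1+(q-1)x);\,Zq^{-r},\,1\mid q^r\big)$, $n\geq 0$. Then for every $n\ge0$ $$\frac{L_q(-n,c,r)(z)}{L_q(0,c,r)(z)}=\mu_n\big|_{Z=z^r}.$$
   Context: Notation: $[m]_q=\frac{1-q^m}{1-q}$, and $(a;q)_n=(1-a)(1-aq)\cdots(1-aq^{n-1})$. $L_q(-n,c,r)(z)$ is the value on the power series $f(z)=z$ of the operator $L_q(s,c,r)=\sum_{m\ge1,\ m\equiv c\,(\mathrm{mod}\ r)}\frac{1}{[m]_q^s}F_m$ at $s=-n$, where $F_m(f)(q,z)=f(q^m,z^m)$ acts on formal power series in $z$ without constant term over $\mathbb{Q}(q)$; this gives the displayed series. It is a formal power series in $z$ over $\mathbb{Q}(q)$ (and is in fact the expansion of a rational function in $q$ and $z$). Little $q$-Jacobi polynomials (with base $q$): $$p_n(x;a,b\mid q)=\sum_{k=0}^{\infty}\frac{(q^{-n};q)_k\,(abq^{n+1};q)_k}{(aq;q)_k\,(q;q)_k}(qx)^k ,$$ where the terms with $k>n$ vanish; in $p_n(x;a,b\mid q^r)$ every $q$ in this formula is replaced by $q^r$. Moments: write $P_n(x)=p_n(q^{-c}(1+(q-1)x);Zq^{-r},1\mid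 q^r)\in\mathbb{Q}(q,Z)[x]$. The $n$th moment is $\mu_n=\varphi(x^n)$, where $\varphi:\mathbb{Q}(q,Z)[x]\to\mathbb{Q}(q,Z)$ is the unique linear functional with $\varphi(1)=1$ and $\varphi(P_nP_m)=K_n\delta_{n,m}$, $K_n\ne0$, for all $n,m\ge0$.
   Formalization: The formal theorem assumes 1 ≤ c ≤ r instead of an arbitrary integer c; otherwise the claim fails, e.g. r=1, c=0, n=1 gives 1/(1-qz) on the left and z/(1-qz) on the right, and it fails at n=1 for every excluded c. *)

(* Defs.v *)
From HB Require Import structures.
From mathcomp Require Import all_boot all_order all_algebra.
From mathcomp Require Import boolp.

Set Implicit Arguments.
Unset Strict Implicit.
Unset Printing Implicit Defensive.

Import GRing.Theory.
Local Open Scope ring_scope.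
Local Open Scope quotient_scope.

(* Formal power series f_0 + f_1 z + f_2 z^2 + ..., as an integral domain. *)

Record fps (R : Type) := Fps { fpscoef : nat -> R }.

HB.instance Definition _ (R : Type) := gen_eqMixin (fps R).
HB.instance Definition _ (R : Type) := gen_choiceMixin (fps R).

Lemma fpsP (R : Type) (f g : fps R) : fpscoef f =1 fpscoef g -> f = g.
Proof. by case: f => f; case: g => g /= /funext ->. Qed.

Section FpsRing.
Variable R : idomainType.
Implicit Types f g h : fps R.

Definition fps_const (a : R) : fps R := Fps (fun n => if n == 0%N then a else 0).
Definition fps_X : fps R := Fps (fun n => (n == 1%N)%:R).
Definition fps_opp f : fps R := Fps (fun n => - fpscoef f n).
Definition fps_add f g : fps R := Fps (fun n => fpscoef f n + fpscoef g n).
Definition fps_mul f g : fps R :=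
  Fps (fun n => \sum_(i < n.+1) fpscoef f i * fpscoef g (n - i)).

Fact fps_addA : associative fps_add.
Proof. by move=> f g h; apply: fpsP => n /=; rewrite addrA. Qed.
Fact fps_addC : commutative fps_add.
Proof. by move=> f g; apply: fpsP => n /=; rewrite addrC. Qed.
Fact fps_add0 : left_id (fps_const 0) fps_add.
Proof. by move=> f; apply: fpsP => n /=; rewrite if_same add0r. Qed.
Fact fps_addN : left_inverse (fps_const 0) fps_opp fps_add.
Proof. by move=> f; apply: fpsP => n /=; rewrite if_same addNr. Qed.

HB.instance Definition _ :=
  GRing.isZmodule.Build (fps R) fps_addA fps_addC fps_add0 fps_addN.

(* Truncation to a polynomial: reduces the ring axioms to those of {poly R}. *)
Let tr n f : {poly R} := \poly_(i < n.+1) fpscoef f i.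

Let trE n f i : (i <= n)%N -> (tr n f)`_i = fpscoef f i.
Proof. by move=> le_in; rewrite coef_poly ltnS le_in. Qed.

Let tr_mul n f g i : (i <= n)%N ->
  fpscoef (fps_mul f g) i = (tr n f * tr n g)`_i.
Proof.
move=> le_in; rewrite coefM; apply: eq_bigr => j _.
have le_ji : (j <= i)%N by rewrite -ltnS.
by rewrite !trE // ?(leq_trans le_ji) // (leq_trans (leq_subr _ _)).
Qed.

Let tr_mull n f (p : {poly R}) g :
  (forall i, (i <= n)%N -> fpscoef g i = p`_i) ->
  fpscoef (fps_mul f g) n = (tr n f * p)`_n.
Proof.
move=> gp; rewrite coefM; apply: eq_bigr => j _.
by rewrite trE -1?ltnS // gp // leq_subr.
Qed.

Fact fps_mulC : commutative fps_mul.
Proof.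
by move=> f g; apply: fpsP => n; rewrite !(tr_mul _ _ (leqnn n)) mulrC.
Qed.

Fact fps_mulA : associative fps_mul.
Proof.
move=> f g h; apply: fpsP => n; rewrite [fps_mul (fps_mul _ _) h]fps_mulC.
rewrite (tr_mull _ (fun i => @tr_mul n g h i)).
by rewrite (tr_mull _ (fun i => @tr_mul n f g i)) mulrA mulrC.
Qed.

Fact fps_mul1 : left_id (fps_const 1) fps_mul.
Proof.
move=> f; apply: fpsP => n /=; rewrite big_ord_recl /= mul1r subn0 big1 ?addr0 //.
by move=> i _; rewrite mul0r.
Qed.

Fact fps_mulDl : left_distributive fps_mul fps_add.
Proof.
move=> f g h; apply: fpsP => n /=; rewrite -big_split.
by apply: eq_bigr => i _; rewrite mulrDl.
Qed.

Fact fps_oner_neq0 : fps_const 1 != 0.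
Proof.
by apply/eqP => /(congr1 (fun f => fpscoef f 0)) /= /eqP; rewrite oner_eq0.
Qed.

HB.instance Definition _ := GRing.Zmodule_isComNzRing.Build (fps R)
  fps_mulA fps_mulC fps_mul1 fps_mulDl fps_oner_neq0.

Definition fps_unit : {pred fps R} := fun f => `[< exists g, g * f = 1 >].
Definition fps_inv f : fps R :=
  if pselect (exists g, g * f = 1) is left ex then projT1 (cid ex) else f.

Fact fps_mulVx : {in fps_unit, left_inverse 1 fps_inv *%R}.
Proof.
move=> f /asboolP exg; rewrite /fps_inv.
by case: pselect => // ex; case: cid.
Qed.
Fact fps_unitPl f g : g * f = 1 -> fps_unit f.
Proof. by move=> gf; apply/asboolP; exists g. Qed.
Fact fps_inv_out : {in [predC fps_unit], fps_inv =1 id}.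
Proof.
move=> f; rewrite inE /= => /asboolP nex; rewrite /fps_inv.
by case: pselect.
Qed.

HB.instance Definition _ := GRing.ComNzRing_hasMulInverse.Build (fps R)
  fps_mulVx fps_unitPl fps_inv_out.

Let fps_val f : f != 0 ->
  exists2 i, fpscoef f i != 0 & forall j, (j < i)%N -> fpscoef f j = 0.
Proof.
move=> nz; have ex : exists i, fpscoef f i != 0.
  apply: contrapT => nex; case/eqP: nz; apply: fpsP => i /=; rewrite if_same.
  by apply/eqP/negPn/negP => fi; apply: nex; exists i.
exists (ex_minn ex); first by case: ex_minnP.
case: ex_minnP => i _ imin j lt_ji; apply/eqP/negPn/negP => /imin.
by rewrite leqNgt lt_ji.
Qed.

Fact fps_integral f g : f * g = 0 -> (f == 0) || (g == 0).
Proof.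
move=> fg0; apply/norP => -[/fps_val[i fi fj] /fps_val[j gj gk]].
move/(congr1 (fun h => fpscoef h (i + j))): fg0 => /=; rewrite if_same.
have lt_i : (i < (i + j).+1)%N by rewrite ltnS leq_addr.
rewrite (bigD1 (Ordinal lt_i)) //= addKn big1 ?addr0 => [/eqP|k].
  by rewrite mulf_eq0 (negPf fi) (negPf gj).
rewrite -val_eqE /= neq_ltn => /orP[lt_ki | lt_ik].
  by rewrite fj ?mul0r.
rewrite gk ?mulr0 // ltn_subLR; last by rewrite -ltnS.
by rewrite ltn_add2r.
Qed.

HB.instance Definition _ := GRing.ComUnitRing_isIntegral.Build (fps R)
  fps_integral.

End FpsRing.

Arguments fps_X {R}.

Section QSeries.
Variable F : fieldType.

Definition qbracket (q : F) (m : nat) : F := (1 - q ^+ m) / (1 - q).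

Definition qpoch (a q : F) (n : nat) : F := \prod_(i < n) (1 - a * q ^+ i).

(* p_n(x; a, b | q); the argument x is a polynomial, so that p_n can be taken
   at an affine function of the variable.  The terms with k > n vanish. *)
Definition little_qJacobi (n : nat) (x : {poly F}) (a b q : F) : {poly F} :=
  \sum_(k < n.+1)
    (qpoch (q ^- n) q k * qpoch (a * b * q ^+ n.+1) q k
      / (qpoch (a * q) q k * qpoch q q k)) *: (q *: x) ^+ k.

(* phi is normalized and makes (P_n) an orthogonal sequence. *)
Definition orthogonality_functional (P : nat -> {poly F})
    (phi : {scalar {poly F}}) : Prop :=
  phi 1 = 1 /\
  exists2 K : nat -> F, forall n, K n != 0 &
    forall n m, phi (P n * P m) = if n == m then K n else 0.

End QSeries.

Notation "x %:F" := (@FracField.tofrac _ x) : ring_scope.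

(* The field Q(q). *)
Definition Qq : fieldType := {fraction {poly rat}}.
Definition varq : Qq := ('X : {poly rat})%:F.

(* The field Q(q, Z) = Q(q)(Z). *)
Definition QqZ : fieldType := {fraction {poly Qq}}.
Definition varZ : QqZ := ('X : {poly Qq})%:F.
Definition Qq_in_QqZ (a : Qq) : QqZ := (a%:P)%:F.

(* The field Q(q)((z)) of formal Laurent series in z. *)
Definition Laurent : fieldType := {fraction fps Qq}.
Definition varz : Laurent := (fps_X : fps Qq)%:F.
Definition Qq_in_Laurent (a : Qq) : Laurent := (fps_const a)%:F.

(* The value of G in Q(q)(Z) at Z = t, namely N(t) / D(t) where G = N / D with
   N and D in Q(q)[Z].  It does not depend on the choice of N and D when t is
   transcendental over Q(q), e.g. when t is a positive power of z. *)
Definition evalZ (G : QqZ) (t : Laurent) : Laurent :=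
  (map_poly Qq_in_Laurent \n_(repr G)).[t]
    / (map_poly Qq_in_Laurent \d_(repr G)).[t].

(* L_q(s, c, r)(z), the sum of z^m / [m]_q^s over m >= 1, m = c (mod r). *)
Definition Lq (s c : int) (r : nat) : fps Qq :=
  Fps (fun m => if (0 < m)%N && (m%:Z == c %[mod r%:Z])%Z
                then (qbracket varq m ^ s)^-1 else 0).

(* p_n(q^(-c) (1 + (q - 1) x); Z q^(-r), 1 | q^r).  It depends on c itself,
   whereas Lq only depends on the class of c modulo r: the two match only when
   c is the least positive representative of its class, 1 <= c <= r. *)
Definition shifted_qJacobi (c : int) (r : nat) (n : nat) : {poly QqZ} :=
  let q := Qq_in_QqZ varq in
  little_qJacobi n (q ^ (- c) *: (1 + (q - 1) *: 'X)) (varZ * q ^- r) 1 (q ^+ r).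

(* Main.v *)
From HB Require Import structures.
Require Import Defs.
From mathcomp Require Import all_boot all_order all_algebra.
From mathcomp Require Import ring zify.

(* Write Q = q^r.  With a = Z / Q and b = 1 the little q-Jacobi polynomials of
   base Q are orthogonal for the measure (1 - Z) \sum_k Z^k \delta_(Q^k), whose
   j-th moment is (1 - Z) / (1 - Z Q^j).  The point y = Q^k corresponds to
   x = (1 - q^(c + r k)) / (1 - q) = [c + r k]_q, so that the n-th moment in x is
   (1 - Z) \sum_k Z^k [c + r k]_q^n, which at Z = z^r is the quotient of the two
   L-series.

   Orthogonality: the integral of y^j p_n(y) is, up to a nonzero factor, the value
   at Z of the operator \prod_(i < n) (1 - Q^-i T), (T f)(w) = f(Q w), applied to
   f(w) = (w; Q)_n / (1 - w Q^j).  This operator kills polynomials of degree < n,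
   so only the remainder (Q^-j; Q)_n / (1 - w Q^j) of the division of (w; Q)_n by
   1 - w Q^j contributes, and it vanishes exactly when j < n. *)

Set Implicit Arguments.
Unset Strict Implicit.
Unset Printing Implicit Defensive.

Import GRing.Theory.
Local Open Scope ring_scope.
Local Open Scope quotient_scope.

(** * Identities and non-vanishing of q-Pochhammer symbols *)

Section QPochhammer.
Variable F : fieldType.
Implicit Types (a w Q : F) (n k : nat).

Lemma qpoch0 a Q : qpoch a Q 0 = 1.
Proof. exact: big_ord0. Qed.

Lemma qpochS a Q n : qpoch a Q n.+1 = qpoch a Q n * (1 - a * Q ^+ n).
Proof. exact: big_ord_recr. Qed.

Lemma qpochSl a Q n : qpoch a Q n.+1 = (1 - a) * qpoch (a * Q) Q n.
Proof.
rewrite /qpoch big_ord_recl expr0 mulr1; congr (_ * _).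
by apply: eq_bigr => i _; rewrite exprS mulrA.
Qed.

Lemma qpochD a Q m n : qpoch a Q (m + n) = qpoch a Q m * qpoch (a * Q ^+ m) Q n.
Proof.
elim: n => [|n IHn]; first by rewrite addn0 qpoch0 mulr1.
by rewrite addnS !qpochS IHn exprD !mulrA.
Qed.

Lemma qpoch_neq0 a Q n :
  (forall i, (i < n)%N -> 1 - a * Q ^+ i != 0) -> qpoch a Q n != 0.
Proof. by move=> nz; apply/prodf_neq0 => i _; apply: nz. Qed.

Lemma qpochV_eq0 Q n k : Q != 0 -> (n < k)%N -> qpoch (Q ^- n) Q k = 0.
Proof.
move=> Q0 lt_nk; apply/eqP/prodf_eq0; exists (Ordinal lt_nk) => //=.
by rewrite mulVf ?subrr ?expf_neq0.
Qed.

End QPochhammer.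

(** * The q-difference operator behind the orthogonality relations *)

Section QDifference.
Variables (F : fieldType) (Q : F).
Hypotheses (Q0 : Q != 0) (Qn1 : forall n, 1 - Q ^+ n.+1 != 0).

(** The part of the k-th little q-Jacobi coefficient that is free of [a] and [b]; the factor Q^k
    comes from (Q x)^k. *)
Definition qdiff_coef n k := qpoch (Q ^- n) Q k / qpoch Q Q k * Q ^+ k.

Definition qdiff n (f : F -> F) w :=
  \sum_(k < n.+1) qdiff_coef n k * f (Q ^+ k * w).

Lemma qpochQ_neq0 k : qpoch Q Q k != 0.
Proof. by apply: qpoch_neq0 => i _; rewrite -exprS. Qed.

Lemma qdiff_coef0 n : qdiff_coef n 0 = 1.
Proof. by rewrite /qdiff_coef !qpoch0 divr1 mulr1. Qed.

Lemma qdiff_coef_out n : qdiff_coef n n.+1 = 0.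
Proof. by rewrite /qdiff_coef qpochV_eq0 // !mul0r. Qed.

(** A q-Pascal rule, expressing multiplication of a polynomial in T by 1 - Q^-n T. *)
Lemma qdiff_coefS n k :
  qdiff_coef n.+1 k.+1 = qdiff_coef n k.+1 - Q ^- n * qdiff_coef n k.
Proof.
rewrite /qdiff_coef qpochSl.
have -> : Q ^- n.+1 * Q = Q ^- n by rewrite exprS; field; rewrite Q0 expf_neq0.
rewrite !qpochS -exprS !exprS.
have := Qn1 k; have := qpochQ_neq0 k; have := expf_neq0 n Q0; rewrite exprS.
move: (qpoch _ _ _) (qpoch _ _ _) => A B Qn B0 Qk.
by field; rewrite Q0 B0 Qn Qk.
Qed.

(* [qdiff n] is the product of the operators 1 - Q^-i T for i < n, where
   (T f) w = f (Q w); the coefficients come from the q-binomial theorem. *)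
Lemma qdiffS n f w : qdiff n.+1 f w = qdiff n f w - Q ^- n * qdiff n f (Q * w).
Proof.
rewrite /qdiff big_ord_recl qdiff_coef0.
under eq_bigr => k _ do rewrite lift0 qdiff_coefS mulrBl.
rewrite sumrB addrA; congr (_ - _); last first.
  by rewrite mulr_sumr; apply: eq_bigr => k _; rewrite exprSr !mulrA.
rewrite big_ord_recr /= qdiff_coef_out mul0r addr0.
by rewrite [RHS]big_ord_recl qdiff_coef0.
Qed.

Lemma eq_qdiff n f g w :
  (forall k, f (Q ^+ k * w) = g (Q ^+ k * w)) -> qdiff n f w = qdiff n g w.
Proof. by move=> fg; apply: eq_bigr => k _; rewrite fg. Qed.

Lemma qdiffD n f g w :
  qdiff n (fun u => f u + g u) w = qdiff n f w + qdiff n g w.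
Proof. by rewrite -big_split; apply: eq_bigr => k _; rewrite mulrDr. Qed.

Lemma qdiffZ n c f w : qdiff n (fun u => c * f u) w = c * qdiff n f w.
Proof. by rewrite mulr_sumr; apply: eq_bigr => k _; rewrite mulrCA. Qed.

(** u^i is an eigenvector of T for Q^i, so 1 - Q^-l T acts on it as 1 - Q^i Q^-l. *)
Lemma qdiff_exp n i w :
  qdiff n (fun u => u ^+ i) w = \prod_(l < n) (1 - Q ^+ i * Q ^- l) * w ^+ i.
Proof.
elim: n w => [|n IHn] w.
  by rewrite /qdiff big_ord1 qdiff_coef0 big_ord0 !mul1r.
rewrite qdiffS !IHn big_ord_recr /= exprMn.
by ring.
Qed.

Lemma qdiff_poly n (p : {poly F}) w : (size p <= n)%N -> qdiff n (horner p) w = 0.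
Proof.
move=> lt_pn; rewrite (@eq_qdiff n _ (fun u => \sum_(i < size p) p`_i * u ^+ i)).
  rewrite /qdiff; under eq_bigr => k _ do rewrite mulr_sumr.
  rewrite exchange_big big1 //= => i _.
  have := qdiffZ n p`_i (fun u => u ^+ i) w; rewrite /qdiff => ->.
  rewrite -/(qdiff n (fun u => u ^+ i) w) qdiff_exp.
  have lt_in : (i < n)%N := leq_trans (ltn_ord i) lt_pn.
  (* For i < n the factor with l = i is zero. *)
  rewrite (bigD1 (Ordinal lt_in)) //= divff ?expf_neq0 //.
  by rewrite subrr !mul0r mulr0.
by move=> k; rewrite horner_coef.
Qed.

(** Up to common factors, the induction step is the identity 1 / (1 - w) - 1 / (1 - w Q^(n+1)) = w
    (1 - Q^(n+1)) / ((1 - w) (1 - w Q^(n+1))). *)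
Lemma qdiff_inv n w : (forall i, 1 - w * Q ^+ i != 0) ->
  qdiff n (fun u => (1 - u)^-1) w = w ^+ n * qpoch Q Q n / qpoch w Q n.+1.
Proof.
elim: n w => [|n IHn] w w1.
  rewrite /qdiff big_ord1 qdiff_coef0 qpochS !qpoch0 !expr0 !mul1r mulr1.
  by [].
rewrite qdiffS !IHn // => [|i]; last by rewrite [Q * w]mulrC -mulrA -exprS.
rewrite [qpoch w Q n.+2]qpochS [qpoch Q Q n.+1]qpochS (qpochS (Q * w)) (qpochSl w).
rewrite [Q * w]mulrC.
have := w1 0%N; have := w1 n.+1; have := expf_neq0 n Q0.
have : qpoch (w * Q) Q n != 0.
  by apply: qpoch_neq0 => i _; rewrite -mulrA -exprS.
rewrite !exprMn !exprS expr0 mulr1; move: (qpoch _ _ _) (qpoch _ _ _).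
move=> A B A0 Qn0 B1 B2.
by field; rewrite A0 Qn0 B1 B2.
Qed.

Lemma qdiff_qpoch_div n j w : (forall i, 1 - w * Q ^+ i != 0) ->
  qdiff n (fun u => qpoch u Q n / (1 - u * Q ^+ j)) w =
    qpoch (Q ^- j) Q n * (w * Q ^+ j) ^+ n * qpoch Q Q n
      / qpoch (w * Q ^+ j) Q n.+1.
Proof.
move=> w1; pose p : {poly F} := \prod_(i < n) (1 - Q ^+ i *: 'X).
have pE u : p.[u] = qpoch u Q n.
  rewrite horner_prod; apply: eq_bigr => i _.
  by rewrite !(hornerE, hornerZ) mulrC.
have sz_p : (size p <= n.+1)%N.
  apply: leq_trans (size_prod_leq _ _) _; rewrite leq_subLR card_ord.
  apply: (@leq_trans (\sum_(i < n) 2).+1).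
    rewrite ltnS; apply: leq_sum => i _.
    apply: leq_trans (size_polyD _ _) _; rewrite size_polyN geq_max size_poly1 /=.
    by apply: leq_trans (size_scale_leq _ _) _; rewrite size_polyX.
  by rewrite sum_nat_const card_ord muln2 -addnn addnS.
have Qj0 := expf_neq0 j Q0.
have /factor_theorem[R pR] : root (p - (p.[Q ^- j])%:P) (Q ^- j).
  by rewrite rootE !hornerE subrr.
have sz_R : (size R <= n)%N.
  have [-> | R0] := eqVneq R 0; first by rewrite size_poly0.
  have := congr1 (size \o val) pR => /=; rewrite size_Mmonic ?monicXsubC //.
  rewrite size_XsubC addn2 /= => sz_eq; rewrite -ltnS -sz_eq.
  apply: leq_trans (size_polyD _ _) _.
  by rewrite size_polyN geq_max sz_p (leq_trans (size_polyC_leq1 _)).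
pose G := qpoch (Q ^- j) Q n.
(* Since 1 - Q^j u = - Q^j (u - Q^-j), dividing by it instead of u - Q^-j turns the quotient [R]
   into - Q^-j R and keeps the remainder [G]. *)
rewrite (@eq_qdiff n _ (fun u => - Q ^- j * R.[u] + G * (1 - Q ^+ j * u)^-1)).
  rewrite qdiffD !qdiffZ qdiff_poly // mulr0 add0r.
  have -> : qdiff n (fun u => (1 - Q ^+ j * u)^-1) w =
            qdiff n (fun u => (1 - u)^-1) (Q ^+ j * w).
    by apply: eq_bigr => k _; rewrite mulrCA.
  rewrite qdiff_inv => [|i]; last by rewrite [Q ^+ j * w]mulrC -mulrA -exprD.
  by rewrite /G [Q ^+ j * w]mulrC !mulrA.
move=> k; set u := Q ^+ k * w.
have u1 : 1 - Q ^+ j * u != 0 by rewrite mulrA -exprD mulrC.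
have -> : qpoch u Q n = R.[u] * (u - Q ^- j) + G.
  have := congr1 (fun s : {poly F} => s.[u]) pR; rewrite !hornerE !pE => <-.
  by rewrite subrK.
by field; rewrite u1 Qj0.
Qed.

End QDifference.

(** * Linear functionals given by moments, and orthogonal polynomials *)

Section OrthogonalPolynomials.
Variable F : fieldType.
Implicit Types (p q : {poly F}) (P : nat -> {poly F}) (phi psi : {scalar {poly F}}).

Definition moment_functional (m : nat -> F) (p : {poly F}) : F :=
  \sum_(i < size p) p`_i * m i.

Lemma moment_functional_widen m p n : (size p <= n)%N ->
  moment_functional m p = \sum_(i < n) p`_i * m i.
Proof.
move=> le_pn; rewrite /moment_functional (big_ord_widen n (fun i => p`_i * m i)) //.
rewrite [RHS](bigID (fun i : 'I_n => (i < size p)%N)) /=.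
rewrite [X in _ + X]big1 ?addr0 // => i; rewrite -leqNgt => le_pi.
by rewrite nth_default ?mul0r.
Qed.

Fact moment_functional_is_scalar m : scalar (moment_functional m).
Proof.
move=> a p q /=; set n := maxn (size p) (size q).
have le_n : (size (a *: p + q)%R <= n)%N.
  apply: leq_trans (size_polyD _ _) _; rewrite geq_max leq_maxr andbT.
  by apply: leq_trans (size_scale_leq _ _) _; rewrite leq_maxl.
rewrite !(@moment_functional_widen _ _ n) ?leq_maxl ?leq_maxr // mulr_sumr -big_split.
by apply: eq_bigr => i _; rewrite coefD coefZ mulrDl mulrA.
Qed.

HB.instance Definition _ m := GRing.isLinear.Build F {poly F} F _
  (moment_functional m) (moment_functional_is_scalar m).

Lemma moment_functionalXn m n : moment_functional m 'X^n = m n.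
Proof.
rewrite /moment_functional size_polyXn big_ord_recr /= coefXn eqxx mul1r.
rewrite big1 ?add0r // => i _.
by rewrite coefXn (ltn_eqF (ltn_ord i)) mul0r.
Qed.

(** Subtracting a suitable multiple of [P n] lowers the degree, so the [P n] span all
    polynomials. *)
Lemma eq_scalar_poly P phi psi : (forall n, size (P n) = n.+1) ->
  (forall n, phi (P n) = psi (P n)) -> phi =1 psi.
Proof.
move=> sP eq_P p; have [n] := ubnP (size p).
elim: n p => // -[|n] IHn p; rewrite ltnS.
  by rewrite leqn0 size_poly_eq0 => /eqP ->; rewrite !linear0.
move=> le_pn; have Pn0 : (P n)`_n != 0.
  by have := lead_coef_eq0 (P n); rewrite /lead_coef -size_poly_eq0 sP => ->.
pose a := p`_n / (P n)`_n.
rewrite -[p](subrK (a *: P n)); move def_p': (p - a *: P n) => p'.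
rewrite !linearD !linearZ /= eq_P IHn // -def_p' ltnS.
apply/leq_sizeP => i; rewrite leq_eqVlt => /orP[/eqP <- | lt_ni].
  by rewrite !coefE divfK ?subrr.
by rewrite !coefE !nth_default ?sP ?mulr0 ?subrr // (leq_trans le_pn).
Qed.

(** Orthogonality to the nonzero constant [P 0] forces the value 0 on [P n] for n > 0, and
    normalization fixes the value on [P 0]. *)
Lemma orthogonality_functional_unique P phi psi :
    (forall n, size (P n) = n.+1) ->
  orthogonality_functional P phi -> orthogonality_functional P psi ->
  psi =1 phi.
Proof.
move=> sP [phi1 [K _ phiP]] [psi1 [L _ psiP]].
have [c c0 P0] : exists2 c, c != 0 & P 0 = c%:P by apply/size_poly1P; rewrite sP.
apply: (eq_scalar_poly sP) => -[|n].
  by rewrite P0 -[c%:P]mulr1 mul_polyC !linearZ /= phi1 psi1.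
apply: (mulfI c0); rewrite -!linearZ /= -mul_polyC -P0.
by rewrite phiP psiP.
Qed.

(** The boolean equality packs vanishing for j < n and non-vanishing at j = n. Expand the factor of
    smaller degree in monomials: every term dies for distinct indices, and only the top one survives
    for equal indices. *)
Lemma orthogonality_functional_intro P phi :
    (forall n, size (P n) = n.+1) -> phi 1 = 1 ->
    (forall n j, (j <= n)%N -> (phi ('X^j * P n) == 0) = (j < n)%N) ->
  orthogonality_functional P phi.
Proof.
move=> sP phi1 phiX; split=> //; exists (fun n => phi (P n * P n)).
  move=> n; have Pn0 : (P n)`_n != 0.
    by have := lead_coef_eq0 (P n); rewrite /lead_coef -size_poly_eq0 sP => ->.
  rewrite -{1}[P n]coefK poly_def sP mulr_suml linear_sum big_ord_recr big1 /=.
    by rewrite add0r -scalerAl linearZ mulf_eq0 (negPf Pn0) phiX // ltnn.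
  move=> i _; rewrite -scalerAl linearZ /=; apply/eqP.
  by rewrite mulf_eq0 phiX ?(ltn_ord i) ?orbT // ltnW.
have lt0 m n : (m < n)%N -> phi (P m * P n) = 0.
  move=> lt_mn; rewrite -[P m]coefK poly_def sP mulr_suml linear_sum big1 //= => i _.
  have lt_in : (i < n)%N by rewrite (leq_trans (ltn_ord i)).
  by apply/eqP; rewrite -scalerAl linearZ mulf_eq0 phiX ?lt_in ?orbT // ltnW.
move=> n m; have [lt_nm | lt_mn | -> //] := ltngtP n m; first exact: lt0.
by rewrite mulrC lt0.
Qed.

(** Substituting [B] undoes the substitution of [A]. *)
Lemma orthogonality_functional_comp P psi (A B : {poly F}) : A \Po B = 'X ->
    orthogonality_functional P psi ->
  orthogonality_functional (fun n => P n \Po A) (psi \o comp_poly B).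
Proof.
move=> AB [psi1 [K K0 psiP]]; split; first by rewrite /= comp_polyC psi1.
exists K => // n m.
by rewrite /= comp_polyM -!comp_polyA AB !comp_polyXr psiP.
Qed.

Lemma little_qJacobi_comp n x a b (q : F) :
  little_qJacobi n x a b q = little_qJacobi n 'X a b q \Po x.
Proof.
rewrite /little_qJacobi linear_sum; apply: eq_bigr => k _ /=.
by rewrite linearZ /= rmorphXn /= linearZ /= comp_polyX.
Qed.

End OrthogonalPolynomials.

(** * Orthogonality of the little q-Jacobi polynomials with a = Z / Q and b = 1 *)

Section LittleQJacobi.
Variables (F : fieldType) (Q Z : F).
Hypotheses (Q0 : Q != 0) (Qn1 : forall n, 1 - Q ^+ n.+1 != 0).
Hypotheses (Z0 : Z != 0) (ZQn1 : forall n, 1 - Z * Q ^+ n != 0).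

Local Notation p n := (little_qJacobi n 'X (Z * Q^-1) 1 Q).

(* The moments of (1 - Z) \sum_k Z^k \delta_(Q^k). *)
Definition qJacobi_moment i := (1 - Z) / (1 - Z * Q ^+ i).

Lemma subr1_exprV_neq0 j i : (i < j)%N -> 1 - Q ^- j * Q ^+ i != 0.
Proof.
move=> lt_ij; rewrite -(subnKC lt_ij) addSnnS exprD invfM.
rewrite mulrAC mulVf ?expf_neq0 // mul1r.
by rewrite subr_eq0 eq_sym invr_eq1 eq_sym -subr_eq0.
Qed.

Lemma qpochV_neq0 n j : (n <= j)%N -> qpoch (Q ^- j) Q n != 0.
Proof.
move=> le_nj; apply: qpoch_neq0 => i lt_in.
by apply: subr1_exprV_neq0; rewrite (leq_trans lt_in).
Qed.

Lemma qpochZ_neq0 j n : qpoch (Z * Q ^+ j) Q n != 0.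
Proof. by apply: qpoch_neq0 => i _; rewrite -mulrA -exprD. Qed.

(** Both (Z; Q)_n (Z Q^n; Q)_k and (Z; Q)_k (Z Q^k; Q)_n equal (Z; Q)_(n+k). The coefficient thus
    involves the value at u = Z Q^k of (u; Q)_n, the form that [qdiff] takes. *)
Lemma little_qJacobiE n : p n = \sum_(k < n.+1)
  (qdiff_coef Q n k * (qpoch (Z * Q ^+ k) Q n / qpoch Z Q n)) *: 'X^k.
Proof.
apply: eq_bigr => k _; rewrite exprZn scalerA mulr1 mulfVK // exprS mulrA mulfVK //.
congr (_ *: _); rewrite /qdiff_coef.
have : qpoch Z Q n * qpoch (Z * Q ^+ n) Q k = qpoch Z Q k * qpoch (Z * Q ^+ k) Q n.
  by rewrite -!qpochD addnC.
have := qpochZ_neq0 0 n; have := qpochZ_neq0 0 k; rewrite expr0 mulr1.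
have := qpochQ_neq0 Qn1 k.
move: (qpoch Z Q n) (qpoch Z Q k) (qpoch (Z * _) Q n) (qpoch (Z * _) Q k).
move=> A B C D Q1 B0 A0 e; have -> : C = A * D / B by rewrite e mulrAC divff ?mul1r.
by field; rewrite A0 B0 Q1.
Qed.

Lemma size_little_qJacobi n : size (p n) = n.+1.
Proof.
rewrite little_qJacobiE.
rewrite -(poly_def _ (fun k => qdiff_coef Q n k * (qpoch (Z * Q ^+ k) Q n / _))).
rewrite size_poly_eq //.
rewrite !mulf_neq0 ?invr_neq0 ?expf_neq0 ?qpochV_neq0 ?qpochQ_neq0 ?qpochZ_neq0 //.
by have := qpochZ_neq0 0 n; rewrite expr0 mulr1.
Qed.

(** The moment of order j + k is (1 - Z) / (1 - u Q^j) at u = Z Q^k, so the sum over k is [qdiff n]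
    at Z of (u; Q)_n / (1 - u Q^j), up to a constant. *)
Lemma moment_functional_little_qJacobi n j :
  moment_functional qJacobi_moment ('X^j * p n) =
    (1 - Z) / qpoch Z Q n * (qpoch (Q ^- j) Q n * (Z * Q ^+ j) ^+ n * qpoch Q Q n
      / qpoch (Z * Q ^+ j) Q n.+1).
Proof.
rewrite little_qJacobiE mulr_sumr linear_sum -qdiff_qpoch_div // mulr_sumr.
apply: eq_bigr => k _; rewrite -scalerAr -exprD linearZ /= moment_functionalXn.
rewrite /qJacobi_moment [Q ^+ k * Z]mulrC.
have -> : Z * Q ^+ (j + k) = Z * Q ^+ k * Q ^+ j by rewrite addnC exprD mulrA.
by move: (qdiff_coef Q n k) => C; ring.
Qed.

Lemma little_qJacobi_orthogonal :
  orthogonality_functional (fun n => p n) (moment_functional qJacobi_moment).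
Proof.
apply: orthogonality_functional_intro.
- exact: size_little_qJacobi.
- have Z1 := ZQn1 0; rewrite expr0 mulr1 in Z1.
  have -> : 1 = 'X^0 :> {poly F} by rewrite expr0.
  by rewrite /= moment_functionalXn /qJacobi_moment expr0 mulr1 divff.
move=> n j le_jn /=; rewrite moment_functional_little_qJacobi.
have Z1 := ZQn1 0; rewrite expr0 mulr1 in Z1.
(* Only the factor (Q^-j; Q)_n can vanish. *)
rewrite !mulf_eq0 !invr_eq0 !expf_eq0 !mulf_eq0 expf_eq0.
have := qpochZ_neq0 0 n; rewrite expr0 mulr1 => /negPf ->.
rewrite (negPf Z1) (negPf Z0) (negPf Q0) (negPf (qpochQ_neq0 Qn1 n)).
rewrite (negPf (qpochZ_neq0 _ _)) !(andbF, orbF) /=.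
have [lt_jn | le_nj] := ltnP j n; first by rewrite qpochV_eq0 ?eqxx.
exact/negbTE/qpochV_neq0.
Qed.

End LittleQJacobi.

(** * Coefficients of power series, and transcendence of z^r *)

Section FpsCoef.
Variable R : idomainType.
Implicit Types (f g : fps R) (a : R).

Lemma fpscoefD f g n : fpscoef (f + g) n = fpscoef f n + fpscoef g n.
Proof. by []. Qed.

Lemma fpscoefB f g n : fpscoef (f - g) n = fpscoef f n - fpscoef g n.
Proof. by []. Qed.

Lemma fpscoef0 n : fpscoef (0 : fps R) n = 0.
Proof. by rewrite /= if_same. Qed.

Lemma fpscoef_sum I (s : seq I) (f : I -> fps R) n :
  fpscoef (\sum_(i <- s) f i) n = \sum_(i <- s) fpscoef (f i) n.
Proof.
elim: s => [|i s IHs]; first by rewrite !big_nil fpscoef0.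
by rewrite !big_cons fpscoefD IHs.
Qed.

Lemma fpscoefZ a f n : fpscoef (fps_const a * f) n = a * fpscoef f n.
Proof.
rewrite /= big_ord_recl /= subn0 big1 ?addr0 // => i _.
by rewrite mul0r.
Qed.

Fact fps_const_is_zmod_morphism : zmod_morphism (@fps_const R).
Proof. by move=> a b; apply: fpsP => -[|n] //=; rewrite subrr. Qed.

Fact fps_const_is_monoid_morphism : monoid_morphism (@fps_const R).
Proof.
split=> // a b; apply: fpsP => n; rewrite fpscoefZ /=.
by case: eqP => // _; rewrite mulr0.
Qed.

HB.instance Definition _ := GRing.isZmodMorphism.Build R (fps R)
  (@fps_const R) fps_const_is_zmod_morphism.
HB.instance Definition _ := GRing.isMonoidMorphism.Build R (fps R)
  (@fps_const R) fps_const_is_monoid_morphism.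

Lemma fpscoefXM f n : fpscoef (fps_X * f) n = if n is m.+1 then fpscoef f m else 0.
Proof.
case: n => [|n] /=; first by rewrite big_ord1 mul0r.
rewrite big_ord_recl mul0r add0r big_ord_recl /= mul1r subSS subn0.
by rewrite big1 ?addr0 // => i _; rewrite mul0r.
Qed.

Lemma fpscoefXnM r f n :
  fpscoef (fps_X ^+ r * f) n = if (n < r)%N then 0 else fpscoef f (n - r).
Proof.
elim: r n => [|r IHr] n; first by rewrite expr0 mul1r subn0.
by rewrite exprS -mulrA fpscoefXM; case: n => // n; rewrite IHr ltnS subSS.
Qed.

Lemma fpscoefXn r n : fpscoef (fps_X ^+ r : fps R) n = (n == r)%:R.
Proof.
rewrite -[fps_X ^+ r]mulr1 fpscoefXnM /= subn_eq0.
by case: (ltngtP n r).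
Qed.

Lemma fps_X_neq0 : fps_X != 0 :> fps R.
Proof. by apply/eqP => /(congr1 (fun f => fpscoef f 1)) /eqP /=; rewrite oner_eq0. Qed.

(** As r > 0 keeps the exponents r k distinct, the coefficient of z^(r i) in p(z^r) is the i-th
    coefficient of p. *)
Lemma fps_horner_Xn_neq0 (p : {poly R}) r : (0 < r)%N -> p != 0 ->
  (map_poly (@fps_const R) p).[fps_X ^+ r] != 0.
Proof.
move=> r0; apply: contraNneq => /(congr1 (@fpscoef R)) p0; apply/eqP/polyP => i.
have [lt_ip | le_pi] := ltnP i (size p); last by rewrite coef0 nth_default.
move/(congr1 (@^~ (r * i)%N)): p0; rewrite fpscoef0 coef0.
rewrite horner_coef size_map_inj_poly ?rmorph0 //; last first.
  by move=> a b /(congr1 (fun f => fpscoef f 0)).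
rewrite fpscoef_sum (bigD1_seq (Ordinal lt_ip)) ?index_enum_uniq ?mem_index_enum //.
rewrite coef_map fpscoefZ -exprM fpscoefXn eqxx mulr1 big1 => [/=|k ne_ki].
  by rewrite addr0.
rewrite coef_map fpscoefZ -exprM fpscoefXn.
rewrite eqn_pmul2l // eq_sym -[(k : nat) == i]/(k == Ordinal lt_ip).
by rewrite (negPf ne_ki) mulr0.
Qed.

End FpsCoef.

(** * Embeddings of Q(q) and non-vanishing of denominators *)

HB.instance Definition _ := GRing.RMorphism.copy Qq_in_QqZ
  (@FracField.tofrac {poly Qq} \o polyC).
HB.instance Definition _ := GRing.RMorphism.copy Qq_in_Laurent
  (@FracField.tofrac (fps Qq) \o @fps_const Qq).

Lemma horner_varzXn_neq0 r (p : {poly Qq}) : (0 < r)%N -> p != 0 ->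
  (map_poly Qq_in_Laurent p).[varz ^+ r] != 0.
Proof.
move=> r0 p0; rewrite /varz -rmorphXn.
have -> : map_poly Qq_in_Laurent p =
    map_poly (@FracField.tofrac (fps Qq)) (map_poly (@fps_const Qq) p).
  by apply/polyP => i; rewrite !coef_map.
by rewrite horner_map /= tofrac_eq0 fps_horner_Xn_neq0.
Qed.

(** Links an element to the representative that [evalZ] reads. *)
Lemma fraction_numden (R : idomainType) (x : {fraction R}) :
  x = (\n_(repr x))%:F / (\d_(repr x))%:F.
Proof.
apply: (canRL (mulfK _)); first by rewrite tofrac_eq0 denom_ratioP.
rewrite -{1}[x]reprK -[_ * _]/(FracField.mul _ _) !piE.
apply/eqmodP; rewrite /= FracField.equivfE /FracField.mulf.
by rewrite !numden_Ratio ?mulf_neq0 ?oner_eq0 ?denom_ratioP // !mulr1 mulrC.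
Qed.


Lemma varq_expn_neq1 n : 1 - varq ^+ n.+1 != 0.
Proof.
rewrite /varq -rmorphXn -(rmorph1 (@FracField.tofrac {poly rat})) -rmorphB.
rewrite tofrac_eq0 -oppr_eq0 opprB.
by rewrite -size_poly_eq0 size_XnsubC.
Qed.

Lemma varq_neq0 : varq != 0.
Proof. by rewrite tofrac_eq0 polyX_eq0. Qed.

Lemma varZ_neq0 : varZ != 0.
Proof. by rewrite tofrac_eq0 polyX_eq0. Qed.

Lemma subr1_ZX_neq0 (F : fieldType) (a : F) : 1 - a *: 'X != 0 :> {poly F}.
Proof.
apply/eqP => /(congr1 (fun p : {poly F} => p`_0)) /eqP.
by rewrite !coefE mulr0 subr0 oner_eq0.
Qed.

Lemma subr1_varZ_neq0 (a : Qq) : 1 - varZ * Qq_in_QqZ a != 0.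
Proof.
have -> : 1 - varZ * Qq_in_QqZ a = (1 - a *: 'X)%:F.
  by rewrite -mul_polyC rmorphB rmorph1 rmorphM mulrC.
by rewrite tofrac_eq0 subr1_ZX_neq0.
Qed.

(** * Images of 1 - a X and a (1 - X), the building blocks of the moments *)

Section LinearFactors.
Variables (R S : comNzRingType).

Lemma rmorph_subr1ZX (f : {rmorphism {poly R} -> S}) a :
  f (1 - a *: 'X) = 1 - f 'X * f a%:P.
Proof. by rewrite -mul_polyC rmorphB rmorph1 rmorphM mulrC. Qed.

Lemma rmorph_scale_subr1X (f : {rmorphism {poly R} -> S}) a :
  f (a *: (1 - 'X)) = f a%:P * (1 - f 'X).
Proof. by rewrite -mul_polyC rmorphM rmorphB rmorph1. Qed.

Lemma horner_map_subr1ZX (f : {rmorphism R -> S}) a x :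
  (map_poly f (1 - a *: 'X)).[x] = 1 - x * f a.
Proof. by rewrite rmorphB rmorph1 /= map_polyZ /= map_polyX !hornerE mulrC. Qed.

Lemma horner_map_scale_subr1X (f : {rmorphism R -> S}) a x :
  (map_poly f (a *: (1 - 'X))).[x] = f a * (1 - x).
Proof. by rewrite map_polyZ /= rmorphB rmorph1 /= map_polyX !hornerE. Qed.

End LinearFactors.

(** * Evaluation of rational functions at Z = z^r *)

Section EvalZ.
Variable r : nat.
Hypothesis r0 : (0 < r)%N.
Local Notation t := (varz ^+ r).
Local Notation ev p := ((map_poly Qq_in_Laurent p).[t]).

(** Two fractions for one element cross-multiply to an identity in Q(q)[Z], which survives
    evaluation; denominators stay nonzero because z^r is transcendental over Q(q). *)
Lemma evalZ_fraction (N D : {poly Qq}) : D != 0 ->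
  evalZ (N%:F / D%:F) t = ev N / ev D.
Proof.
move=> D0; rewrite /evalZ; have := fraction_numden (N%:F / D%:F).
have := denom_ratioP (repr (N%:F / D%:F)).
move: (\n_ _) (\d_ _) => N' D' D'0 /eqP.
rewrite eqr_div ?tofrac_eq0 // -!rmorphM tofrac_eq => /eqP e.
apply/eqP; rewrite eqr_div ?horner_varzXn_neq0 //.
by rewrite -!hornerM -!rmorphM e.
Qed.

Lemma evalZD (G H : QqZ) : evalZ (G + H) t = evalZ G t + evalZ H t.
Proof.
rewrite (fraction_numden G) (fraction_numden H).
have := denom_ratioP (repr G); have := denom_ratioP (repr H).
move: (\n_ _) (\d_ _) (\n_ _) (\d_ _) => N D N' D' D0 D'0.
rewrite addf_div ?tofrac_eq0 // -!rmorphM -rmorphD !evalZ_fraction ?mulf_neq0 //.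
rewrite addf_div ?horner_varzXn_neq0 //.
by rewrite -!hornerM -!(rmorphM (map_poly _)) -hornerD -(rmorphD (map_poly _)).
Qed.

Lemma evalZ0 : evalZ 0 t = 0.
Proof.
have := evalZD 0 0; rewrite (addr0 (0 : QqZ)).
by move: (evalZ 0 t) => e /(congr1 (fun x => x - e)); rewrite addrK subrr.
Qed.

Lemma evalZ_sum I (s : seq I) (G : I -> QqZ) :
  evalZ (\sum_(i <- s) G i) t = \sum_(i <- s) evalZ (G i) t.
Proof. exact: (big_morph (fun G => evalZ G t) evalZD evalZ0). Qed.

Lemma evalZ_qJacobi_moment (a b : Qq) :
  evalZ (Qq_in_QqZ a * ((1 - varZ) / (1 - varZ * Qq_in_QqZ b))) t =
    Qq_in_Laurent a * ((1 - t) / (1 - t * Qq_in_Laurent b)).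
Proof.
rewrite mulrA -(rmorph_scale_subr1X (@FracField.tofrac {poly Qq})).
rewrite -(rmorph_subr1ZX (@FracField.tofrac {poly Qq})).
rewrite evalZ_fraction ?subr1_ZX_neq0 //.
rewrite (horner_map_scale_subr1X Qq_in_Laurent a t).
rewrite (horner_map_subr1ZX Qq_in_Laurent b t).
exact/esym/mulrA.
Qed.

End EvalZ.

(** * Closed form of the quotient of the two L-series *)

Lemma qbracket_expn (F : fieldType) (q : F) m n : qbracket q m ^+ n =
  \sum_(j < n.+1) (1 - q) ^- n * (-1) ^+ j *+ 'C(n, j) * (q ^+ j) ^+ m.
Proof.
rewrite /qbracket exprMn exprVn exprBn mulr_suml; apply: eq_bigr => j _.
by rewrite expr1n mulr1 -!exprM [(j * m)%N]mulnC !mulrnAl mulrC mulrA.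
Qed.

Lemma mulr_sign_exprM (F : fieldType) (a q : F) c j k :
  a * (-1) ^+ j *+ k * (q ^+ j) ^+ c = a * (- q ^+ c) ^+ j *+ k.
Proof.
by rewrite [(- q ^+ c) ^+ j]exprNn -!exprM [(c * j)%N]mulnC mulrnAl mulrA.
Qed.

Lemma cancel_mulf_div (F : fieldType) (a b x d e : F) : x != 0 ->
  a * (b * x / d) / (x / e) = a * b * (e / d).
Proof.
by move=> x0; rewrite invf_div; move: d^-1 => d'; field.
Qed.

Section LSeries.
Variables (c r : nat).
Hypotheses (c_gt0 : (0 < c)%N) (le_cr : (c <= r)%N).

Let r_gt0 : (0 < r)%N := leq_trans c_gt0 le_cr.

Let eqz_nat_mod m : (m%:Z == c %[mod r%:Z])%Z = (m == c %[mod r])%N.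
Proof. by rewrite !modz_nat eqz_nat. Qed.

Let eqn_mod_class m : (0 < m <= r)%N -> (m == c %[mod r])%N = (m == c).
Proof.
case: m => // m /= lt_mr; case: c c_gt0 le_cr => // d _ lt_dr.
by rewrite -[m.+1]addn1 -[d.+1]addn1 eqn_modDr !modn_small // eqn_add2r.
Qed.

(** The geometric series in a z restricted to a residue class, with sum (a z)^c / (1 - (a z)^r). *)
Definition geometric_class (a : Qq) : fps Qq :=
  Fps (fun m => if (0 < m)%N && (m%:Z == c %[mod r%:Z])%Z then a ^+ m else 0).

(** Multiplying by 1 - (a z)^r subtracts from each term the one coming from its predecessor in the
    class. Only the first term remains, of exponent c because 1 <= c <= r. *)
Lemma geometric_classM a :
  geometric_class a * (1 - fps_X ^+ r * fps_const (a ^+ r)) =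
    fps_const (a ^+ c) * fps_X ^+ c.
Proof.
apply: fpsP => m; rewrite mulrBr mulr1 fpscoefB mulrCA fpscoefXnM.
rewrite [_ * fps_const _]mulrC !fpscoefZ fpscoefXn [fpscoef (geometric_class _)]/=.
have [lt_mr | le_rm] := ltnP m r.
  rewrite subr0 eqz_nat_mod.
  case: m => [|m] in lt_mr *; first by rewrite /= ltn_eqF ?mulr0.
  rewrite eqn_mod_class ?(ltnW lt_mr) //=.
  by case: eqP => [->|_]; rewrite ?mulr1 ?mulr0.
rewrite -(subnK le_rm); move: (m - r)%N => k; rewrite addnK /=.
rewrite !eqz_nat_mod modnDr addn_gt0 r_gt0 orbT /=.
(* At exponent r the shifted series contributes its constant coefficient, which is 0, so a term
   remains exactly when c = r. *)
case: k => [|k] /=.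
  have -> : (0 == c %[mod r])%N = (r == c).
    by rewrite -eqn_mod_class ?r_gt0 ?leqnn // modnn mod0n.
  rewrite mulr0 subr0 add0n.
  by case: eqP => [->|_]; rewrite ?mulr1 ?mulr0.
rewrite [(_ + r == c)%N]gtn_eqF ?mulr0; last by lia.
by case: ifP; rewrite ?mulr0 ?subrr // exprD mulrC subrr.
Qed.

Lemma geometric_class_Laurent a : (geometric_class a)%:F =
  Qq_in_Laurent (a ^+ c) * varz ^+ c / (1 - varz ^+ r * Qq_in_Laurent (a ^+ r)).
Proof.
apply: (canRL (mulfK _)).
  rewrite -(horner_map_subr1ZX Qq_in_Laurent).
  exact: horner_varzXn_neq0 r_gt0 (subr1_ZX_neq0 _).
rewrite /varz -!tofracXn -tofracM -tofrac1 -tofracB -!tofracM.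
by rewrite geometric_classM.
Qed.

Lemma Lq0E : Lq 0 c r = geometric_class 1.
Proof. by apply: fpsP => m /=; rewrite expr0z invr1 expr1n. Qed.

(** The binomial expansion of (1 - q^m)^n makes [m]_q^n a combination of the (q^j)^m. *)
Lemma LqNE n : Lq (- n%:Z) c r = \sum_(j < n.+1)
  fps_const ((1 - varq) ^- n * (-1) ^+ j *+ 'C(n, j)) * geometric_class (varq ^+ j).
Proof.
apply: fpsP => m; rewrite fpscoef_sum; under eq_bigr => j _ do rewrite fpscoefZ /=.
rewrite [fpscoef _ _]/=; case: ifP => _; last by rewrite big1 // => j _; rewrite mulr0.
by rewrite -exprnN invrK -qbracket_expn.
Qed.

(** In each quotient z^c cancels, and the remaining q^(j c) joins (-1)^j to form (- q^c)^j. *)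
Lemma Lq_ratio n : (Lq (- n%:Z) c r)%:F / (Lq 0 c r)%:F =
  \sum_(j < n.+1)
    Qq_in_Laurent ((1 - varq) ^- n * (- varq ^+ c) ^+ j *+ 'C(n, j)) *
      ((1 - varz ^+ r) / (1 - varz ^+ r * Qq_in_Laurent ((varq ^+ r) ^+ j))).
Proof.
rewrite LqNE Lq0E rmorph_sum mulr_suml; apply: eq_bigr => j _ /=.
rewrite tofracM !geometric_class_Laurent -[(fps_const _)%:F]/(Qq_in_Laurent _).
rewrite !expr1n (rmorph1 Qq_in_Laurent) mul1r mulr1.
rewrite cancel_mulf_div; last by rewrite expf_neq0 // tofrac_eq0 fps_X_neq0.
by rewrite -(rmorphM Qq_in_Laurent) mulr_sign_exprM -!exprM [(j * r)%N]mulnC.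
Qed.

End LSeries.

(** * The shifted polynomials and their moments *)

Section ShiftedLittleQJacobi.
Variables (F : fieldType) (q Z : F) (c r : nat).
Hypotheses (q0 : q != 0) (q1 : 1 - q != 0).
Hypotheses (qrn1 : forall n, 1 - (q ^+ r) ^+ n.+1 != 0).
Hypotheses (Z0 : Z != 0) (Zqrn1 : forall n, 1 - Z * (q ^+ r) ^+ n != 0).

Local Notation A := (q ^ (- c%:Z) *: (1 + (q - 1) *: 'X) : {poly F}).
Local Notation B := ((1 - q)^-1 *: (1 - q ^+ c *: 'X) : {poly F}).
Local Notation P n := (little_qJacobi n A (Z * q ^- r) 1 (q ^+ r)).

(** [B] inverts the affine map [A] and sends the mass point y = q^(r k) to x = [c + r k]_q. *)
Definition shifted_functional : {scalar {poly F}} :=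
  moment_functional (qJacobi_moment (q ^+ r) Z) \o comp_poly B.

Lemma shift_comp : A \Po B = 'X.
Proof.
rewrite comp_polyZ comp_polyD comp_polyZ comp_polyX -polyC1 comp_polyC -exprnN.
rewrite scalerA -[q - 1]opprB mulNr divff // scaleN1r opprB.
by rewrite addrC subrK scalerA mulVf ?scale1r ?expf_neq0.
Qed.

Lemma size_shift : size A = 2.
Proof.
rewrite -exprnN size_scale ?invr_eq0 ?expf_neq0 //.
have q1' : q - 1 != 0 by rewrite -opprB oppr_eq0.
have sX : size ((q - 1) *: 'X) = 2 by rewrite size_scale ?size_polyX.
by rewrite addrC size_polyDl sX ?size_poly1.
Qed.

Lemma size_shifted n : size (P n) = n.+1.
Proof.
rewrite little_qJacobi_comp size_comp_poly2 ?size_shift //.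
by apply: size_little_qJacobi; rewrite // expf_neq0.
Qed.

Lemma shifted_orthogonal :
  orthogonality_functional (fun n => P n) shifted_functional.
Proof.
have qr0 : q ^+ r != 0 by rewrite expf_neq0.
have [phi1 [K K0 phiP]] := orthogonality_functional_comp shift_comp
  (little_qJacobi_orthogonal qr0 qrn1 Z0 Zqrn1).
split=> //; exists K => // n m.
by rewrite [P n]little_qJacobi_comp [P m]little_qJacobi_comp phiP.
Qed.

(** The binomial expansion of the n-th power of [B], arranged to match [Lq_ratio] term by term. *)
Lemma shifted_functionalXn n : shifted_functional 'X^n =
  \sum_(j < n.+1) ((1 - q) ^- n * (- q ^+ c) ^+ j *+ 'C(n, j)) *
     ((1 - Z) / (1 - Z * (q ^+ r) ^+ j)).
Proof.
rewrite /shifted_functional /= comp_Xn_poly exprZn exprBn linearZ linear_sum /=.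
rewrite mulr_sumr exprVn; apply: eq_bigr => j _.
rewrite expr1n mulr1 exprZn -scalerAr linearMn linearZ /=.
rewrite -(rmorph_sign polyC j) mul_polyC linearZ /= moment_functionalXn.
rewrite [(- q ^+ c) ^+ j]exprNn /qJacobi_moment; move: (_ / _) => m.
by rewrite !mulrnAr !mulrnAl; congr (_ *+ _); ring.
Qed.

End ShiftedLittleQJacobi.

Lemma rmorph_moment_coef (F K : fieldType) (f : {rmorphism F -> K}) x c n j k :
  f ((1 - x) ^- n * (- x ^+ c) ^+ j *+ k) =
    (1 - f x) ^- n * (- f x ^+ c) ^+ j *+ k.
Proof.
by rewrite rmorphMn rmorphM fmorphV !rmorphXn rmorphN rmorphB rmorph1 rmorphXn.
Qed.

Theorem mainTheorem3 (c : int) (r : nat) (r_ge1 : (1 <= r)%N)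
    (c_range : 1 <= c <= r%:Z) :
  exists phi : {scalar {poly QqZ}},
    [/\ orthogonality_functional (shifted_qJacobi c r) phi,
        forall psi : {scalar {poly QqZ}},
          orthogonality_functional (shifted_qJacobi c r) psi -> psi =1 phi
      & forall n : nat,
          (Lq (- n%:Z) c r)%:F / (Lq 0 c r)%:F
            = evalZ (phi 'X^n) (varz ^+ r) :> Laurent].
Proof.
(* The lower bound on [c] excludes negative integers. *)
case: c c_range => // c /andP[c_gt0 le_cr].
pose q := Qq_in_QqZ varq.
have q0 : q != 0 by rewrite (fmorph_eq0 Qq_in_QqZ) varq_neq0.
have qX m : q ^+ m = Qq_in_QqZ (varq ^+ m) by rewrite (rmorphXn Qq_in_QqZ).
have qn1 m : 1 - q ^+ m.+1 != 0.
  rewrite qX -(rmorph1 Qq_in_QqZ) -(rmorphB Qq_in_QqZ) (fmorph_eq0 Qq_in_QqZ).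
  exact: varq_expn_neq1.
have qrn1 m : 1 - (q ^+ r) ^+ m.+1 != 0.
  (* As r >= 1, a positive power of q^r is a positive power of q. *)
  have [k k_eq] : exists k, (r * m.+1 = k.+1)%N.
    by case: r r_ge1 {le_cr} => // r' _; exists (m + r' * m.+1)%N.
  rewrite -(exprM q r) k_eq; exact: qn1.
have Zqrn1 m : 1 - varZ * (q ^+ r) ^+ m != 0.
  by rewrite -exprM qX subr1_varZ_neq0.
have orth := shifted_orthogonal c (q0) (qn1 0) qrn1 varZ_neq0 Zqrn1.
exists (shifted_functional q varZ c r); split.
- exact: orth.
- move=> psi; apply: orthogonality_functional_unique orth => n.
  exact: size_shifted (qn1 0) qrn1 Zqrn1 n.
move=> n; rewrite (@Lq_ratio c r) // shifted_functionalXn evalZ_sum //.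
apply: eq_bigr => j _.
rewrite -(evalZ_qJacobi_moment r_ge1).
rewrite (rmorph_moment_coef Qq_in_QqZ varq c) (rmorphXn Qq_in_QqZ j (varq ^+ r)).
by rewrite (rmorphXn Qq_in_QqZ r varq).
Qed.
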